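(* For every graph $G$ with circumference $k$ and girth at least $5$, and for every vertex $v$ of $G$, there is a $2$-colouring of $G$ with clustering $(4k^2)^{k^2}$ such that $v$ is properly coloured.
   Context: Graphs are finite, simple and undirected. The circumference of a graph that is not a forest is the length of its longest cycle; the circumference of a forest is $2$. The girth of a graph is the length of its shortest cycle (infinite for a forest). A $2$-colouring assigns one of at most two colours to each vertex (not necessarily properly). A monochromatic component is a connected component of the subgraph induced by all vertices of a single colour. A colouring has clustering $c$ if every monochromatic component has at most $c$ vertices. In a coloured graph $G$, a vertex $v$ is properly coloured if the colour of $v$ differs from the colour of $w$ for each edge $vw\in E(G)$. *)

(* Defs.v *)
From mathcomp Require Import all_boot.

Set Implicit Arguments.
Unset Strict Implicit.
Unset Printing Implicit Defensive.

Record graph := Graph {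
  vertex :> finType;
  adj : rel vertex;
  adj_sym : symmetric adj;
  adj_irr : irreflexive adj
}.

Section Cycles.
Variable G : graph.

(* The lower bound on the size matters: for an edge xy, [:: x; y] is also a
   duplicate-free closed walk for [ucycleb]. *)
Definition is_cycle (c : seq G) : bool := (3 <= size c) && ucycleb (@adj G) c.

(* Bounding lengths by #|G| loses nothing, as cycles are duplicate-free;
   see [cycle_lengthsP]. *)
Definition cycle_lengths : {set 'I_#|G|.+1} :=
  [set n : 'I_#|G|.+1 | [exists c : n.-tuple G, is_cycle c]].

Definition forest : bool := cycle_lengths == set0.

Definition circumference : nat :=
  if forest then 2 else \max_(n in cycle_lengths) n.

(* [None] stands for infinite girth. *)
Definition girth : option nat :=
  if [pick n in cycle_lengths] is Some n0
  then Some (nat_of_ord [arg min_(n < n0 in cycle_lengths) nat_of_ord n])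
  else None.

Definition girth_at_least (m : nat) : bool :=
  if girth is Some g then m <= g else true.

Lemma is_cycle_size c : is_cycle c -> size c < #|G|.+1.
Proof. by case/and3P=> _ _ /card_uniqP <-; rewrite ltnS max_card. Qed.

Lemma cycle_lengthsP (n : 'I_#|G|.+1) :
  reflect (exists2 c : seq G, is_cycle c & size c = n) (n \in cycle_lengths).
Proof.
rewrite inE; apply: (iffP existsP) => [[c cc]|[c cc sc]].
  by exists (tval c); rewrite ?size_tuple.
by exists (Tuple (introT eqP sc)).
Qed.

Lemma mem_cycle_lengths c (cc : is_cycle c) :
  Ordinal (is_cycle_size cc) \in cycle_lengths.
Proof. by apply/cycle_lengthsP; exists c. Qed.

Lemma forestP : reflect (forall c : seq G, ~~ is_cycle c) forest.
Proof.
apply: (iffP eqP) => [F c|F].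
  by apply/negP => cc; have := mem_cycle_lengths cc; rewrite F inE.
apply/setP => n; rewrite in_set0; apply/cycle_lengthsP => -[c cc _].
by have := F c; rewrite cc.
Qed.

Lemma circumference_forest : forest -> circumference = 2.
Proof. by rewrite /circumference => ->. Qed.

Lemma circumference_max c : is_cycle c -> size c <= circumference.
Proof.
move=> cc; rewrite /circumference; case: ifP => [/forestP/(_ c)|_].
  by rewrite cc.
exact: (@leq_bigmax_cond _ _ (fun n : 'I_#|G|.+1 => nat_of_ord n) _
          (mem_cycle_lengths cc)).
Qed.

Lemma circumference_attained :
  ~~ forest -> exists2 c : seq G, is_cycle c & size c = circumference.
Proof.
move=> nF; rewrite /circumference (negbTE nF).
have [|n nL ->] := @eq_bigmax_cond _ (mem cycle_lengths)
                     (fun n : 'I_#|G|.+1 => nat_of_ord n).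
  by rewrite card_gt0.
exact/cycle_lengthsP.
Qed.

Lemma girth_at_leastP m :
  reflect (forall c : seq G, is_cycle c -> m <= size c) (girth_at_least m).
Proof.
rewrite /girth_at_least /girth; case: pickP => [n0 n0L|L0]; last first.
  left=> c cc.
  by have := L0 (Ordinal (is_cycle_size cc)); rewrite mem_cycle_lengths.
case: arg_minnP => // n nL nmin; apply: (iffP idP) => [mn c cc|].
  exact: leq_trans mn (nmin _ (mem_cycle_lengths cc)).
by case/cycle_lengthsP: nL => c cc <-; apply.
Qed.

End Cycles.

Section Colourings.
Variables (G : graph) (C : eqType).

Definition induced_adj (A : {set G}) : rel G :=
  [rel x y | [&& x \in A, y \in A & adj x y]].

Definition components (A : {set G}) : {set {set G}} :=
  [set [set y in A | connect (induced_adj A) x y] | x in A].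

Definition monochromatic_component (f : G -> C) (M : {set G}) : Prop :=
  exists a : C, M \in components [set x | f x == a].

Definition has_clustering (f : G -> C) (c : nat) : Prop :=
  forall M : {set G}, monochromatic_component f M -> #|M| <= c.

Definition properly_coloured (f : G -> C) (v : G) : Prop :=
  forall w : G, adj v w -> f v != f w.

End Colourings.

(* Main.v *)
Require Import Defs.
From mathcomp Require Import all_boot.
From mathcomp Require Import zify.

(* Take a normal spanning forest of G having v as a root (adjacent vertices are
   comparable in the tree order) and colour every vertex opposite to its highest
   neighbour above it. Then v is properly coloured, and a monochromatic edge uw
   with u above w comes with a third vertex a above u adjacent to w. Let M be a
   monochromatic component with highest vertex r.

   The depth of M below r is at most (k-2)^2: every tree vertex strictly above
   the bottom of a branch of M is jumped over by such an edge aw, and jumping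
   greedily as far down as possible yields two paths that are disjoint but for
   their origin, leapfrogging each other down the branch as in Dirac's theorem on
   long cycles in 2-connected graphs; they always close up to a cycle.

   The branching of M is at most k^2: the edges uw and aw leading into a branch
   below y start at ancestors of y that are less than k levels above w, as they
   close cycles with tree paths, and a and u have only one common neighbour,
   since there is no 4-cycle. *)

Set Implicit Arguments.
Unset Strict Implicit.
Unset Printing Implicit Defensive.

(** * Normal spanning forests with a prescribed root *)

Section TreeOrders.
Variable G : graph.
Implicit Types (T : rel G) (a b u v w x y z : G).

(** [T x y] reads: [x] is [y] or an ancestor of [y]. As covering pairs are edges, this is the
    ancestor order of a rooted spanning forest of [G]. *)
Record tree_order T : Prop := TreeOrder {
  tree_refl : reflexive T;
  tree_anti : antisymmetric T;
  tree_trans : transitive T;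
  tree_chain : forall x y z, T x z -> T y z -> T x y || T y x;
  tree_cover : forall x y, T x y -> x != y ->
    (forall u, T x u -> T u y -> (u == x) || (u == y)) -> adj x y
}.

Definition normal_order T : Prop :=
  tree_order T /\ forall x y, adj x y -> T x y || T y x.

Definition minimal T v : Prop := forall u, T u v -> u = v.

(** The subtree rooted at [y] is cut off and hung below [x] as a child. *)
Definition graft T x y : rel G :=
  fun a b => if T y b then T y a && T a b || T a x else T a b.

(* The second summand makes every vertex above which [v] lies outweigh all the
   others, so that a maximal order never has to move [v]. *)
Definition weight T v b : nat := #|[set a | T a b]| + #|G| * T v b.

Section Graft.
Variables (T : rel G) (x y : G).
Hypotheses (HT : tree_order T) (nyx : ~~ T y x).

Let Trefl := tree_refl HT.
Let Ttrans := tree_trans HT.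

Lemma graft_tree_order : adj x y -> tree_order (graft T x y).
Proof.
move=> xy; have nyT u : T u x -> T y u = false.
  by move=> ux; apply: contraNF nyx => /Ttrans; apply.
split.
- by move=> a; rewrite /graft; case: ifP => [->|_]; rewrite Trefl.
- move=> a b; rewrite /graft.
  case: ifP => yb; case: ifP => ya /andP[].
  + case/orP=> [/andP[_ ab]|/nyT]; last by rewrite ya.
    case/orP=> [/andP[_ ba]|/nyT]; last by rewrite yb.
    by apply: (tree_anti HT); rewrite ab.
  + by move=> _ ba; rewrite (Ttrans yb ba) in ya.
  + by move=> ab; rewrite (Ttrans ya ab) in yb.
  + by move=> ab ba; apply: (tree_anti HT); rewrite ab.
- move=> b a c; rewrite /graft; case: ifP => yb; case: ifP => yc.
  + case/orP=> [/andP[ya ab]|ax].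
      case/orP=> [/andP[_ bc]|/nyT]; last by rewrite yb.
      by rewrite ya (Ttrans ab bc).
    by rewrite ax !orbT.
  + by move=> _ bc; rewrite (Ttrans yb bc) in yc.
  + move=> ab /orP[/andP[yb' _]|bx]; first by rewrite yb' in yb.
    by rewrite (Ttrans ab bx) orbT.
  + exact: Ttrans.
- move=> a b c; rewrite /graft; case: ifP => yc.
    case/orP=> [/andP[ya ac]|ax] /orP[/andP[yb bc]|bx].
    + by rewrite ya yb /=; case/orP: (tree_chain HT ac bc) => ->; rewrite ?orbT.
    + by rewrite ya bx !orbT.
    + by rewrite yb ax !orbT.
    + by rewrite !nyT //; apply: (tree_chain HT) ax bx.
  move=> ac bc; have nyb : T y b = false.
    by apply: contraFF yc => /Ttrans; apply.
  have nya : T y a = false by apply: contraFF yc => /Ttrans; apply.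
  by rewrite nya nyb; apply: (tree_chain HT) ac bc.
- move=> a b; rewrite /graft; case: ifP => yb.
    case/orP=> [/andP[ya ab] nab C|ax nab C].
      apply: (tree_cover HT) => // u au ub.
      apply: C; last by rewrite ub (Ttrans ya au).
      by rewrite (Ttrans ya au) ya au.
    (* A covering pair entering the moved subtree from outside has both [x] and [y] between its
       ends, so it is the edge [xy]. *)
    have := C y; rewrite Trefl yb ax orbT => /(_ isT isT).
    case/orP=> /eqP E; first by move: nyx; rewrite E ax.
    subst b; have := C x; rewrite (negbTE nyx) Trefl orbT => /(_ ax isT).
    by case/orP=> /eqP E; [rewrite -E|rewrite E adj_irr in xy].
  move=> ab nab C; apply: (tree_cover HT) => // u au ub; apply: C => //.
  by case: ifP => // yu; rewrite (Ttrans yu ub) in yb.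
Qed.

Variable v : G.
Hypothesis (vmin : minimal T v) (le_yx : weight T v y <= weight T v x).

(** The weight of [v] exceeds [#|G|], whereas a vertex outside the subtree of [v] weighs at most
    [#|G|]. *)
Lemma graft_moves_nonroot : y != v.
Proof.
apply/eqP=> yv; move: le_yx; rewrite yv {1}/weight Trefl muln1 /weight.
have /negbTE -> : ~~ T v x by rewrite -yv.
rewrite muln0 addn0; have : 0 < #|[set a | T a v]|.
  by apply/card_gt0P; exists v; rewrite inE Trefl.
by have := max_card [set a | T a x]; lia.
Qed.

Lemma graft_minimal : minimal (graft T x y) v.
Proof.
move=> u; rewrite /graft; case: ifP => [/vmin yv|_ /vmin //].
by have := graft_moves_nonroot; rewrite yv eqxx.
Qed.

(** In the moved subtree, the share of the proper ancestors of [y] is traded for that of all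
    ancestors of [x]. By [le_yx] this gains at least 1, because [y] itself is kept. *)
Lemma graft_weight b : weight T v b + T y b <= weight (graft T x y) v b.
Proof.
have nyv : T y v = false by apply: contraNF graft_moves_nonroot => /vmin ->.
rewrite /weight /graft; case: ifP => yb; last by rewrite addn0.
rewrite nyv /=; have -> : T v b = T v y.
  apply/idP/idP => [vb|/Ttrans]; last exact.
  by have := tree_chain HT yb vb; rewrite nyv.
move: le_yx; rewrite /weight.
have -> : #|[set a | T a b]|
    = #|[set a | T y a && T a b]| + #|[set a | T a y] :\ y|.
  rewrite -cardsUI [X in _ + X](_ : _ = 0) ?addn0; last first.
    apply/eqP; rewrite cards_eq0; apply/eqP/setP=> a; rewrite !inE.
    apply/negbTE/negP => /and3P[/andP[ya _] nay ay].
    by case/eqP: nay; apply: (tree_anti HT); rewrite ay.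
  apply: eq_card => a; rewrite !inE; apply/idP/idP.
    move=> ab; rewrite ab andbT.
    case E: (T y a) => //=; have := tree_chain HT yb ab; rewrite E /= => ay.
    by rewrite ay andbT; apply: contraFneq E => ->.
  by case/orP=> [/andP[]|/andP[_ /Ttrans]] //; apply.
have -> : #|[set a | T y a && T a b || T a x]|
    = #|[set a | T y a && T a b]| + #|[set a | T a x]|.
  rewrite -cardsUI [X in _ + X](_ : _ = 0) ?addn0; last first.
    apply/eqP; rewrite cards_eq0; apply/eqP/setP=> a; rewrite !inE.
    apply/negbTE/negP => /andP[/andP[ya _] ax].
    by move: nyx; rewrite (Ttrans ya ax).
  by apply: eq_card => a; rewrite !inE.
have := cardsD1 y [set a | T a y]; rewrite inE Trefl /=.
lia.
Qed.

End Graft.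

Lemma weight_bound T v : \sum_b weight T v b <= #|G| * (2 * #|G|).
Proof.
rewrite -sum_nat_const; apply: leq_sum => b _; rewrite /weight.
by have := max_card [set a | T a b]; case: (T v b); lia.
Qed.

(** Start from the discrete order. While an edge has incomparable ends, graft the lighter end below
    the other; the total weight grows strictly and is bounded. *)
Lemma normal_order_exists v : exists T, normal_order T /\ minimal T v.
Proof.
suff H n T : tree_order T -> minimal T v ->
    #|G| * (2 * #|G|) - \sum_b weight T v b < n ->
    exists T', normal_order T' /\ minimal T' v.
  apply: (H _ eq_op _ _ (ltnSn _)); last by move=> u /eqP.
  split=> [a|a b /andP[/eqP]|b a c /eqP->|a b c /eqP-> /eqP->|a b ->] //.
  by rewrite eqxx.
elim: n T => // n IHn T HT vmin lt_n.
have [p /and3P[xy nxy nyx]|none] :=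
    pickP (fun p : G * G => [&& adj p.1 p.2, ~~ T p.1 p.2 & ~~ T p.2 p.1]);
  last first.
  exists T; split=> //; split=> // x y xy; have := none (x, y).
  by rewrite /= xy -negb_or => /negbFE.
have {p xy nxy nyx} [x [y [xy nyx le_yx]]] : exists x y,
    [/\ adj x y, ~~ T y x & weight T v y <= weight T v x].
  case: (leqP (weight T v p.2) (weight T v p.1)) => [le|/ltnW le].
    by exists p.1, p.2.
  by exists p.2, p.1; rewrite adj_sym.
apply: (IHn (graft T x y)); [exact: graft_tree_order|exact: graft_minimal|].
have gw := graft_weight HT nyx vmin le_yx.
have : \sum_b weight T v b < \sum_b weight (graft T x y) v b.
  rewrite (bigD1 y) // [ltnRHS](bigD1 y) //= -addSn; apply: leq_add.
    by have := gw y; rewrite (tree_refl HT) addn1.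
  by apply: leq_sum => b _; apply: leq_trans (gw b); rewrite leq_addr.
have := weight_bound (graft T x y) v; lia.
Qed.

End TreeOrders.

(** * Tree paths and the cycles they close *)

Section NormalTrees.
Variables (G : graph) (T : rel G) (k : nat).
Hypotheses (HN : normal_order T)
           (circ_le : forall c : seq G, ucycleb (@adj G) c -> size c <= k).
Implicit Types (a b c r s t u w x y z : G) (A B D p q : seq G).

Definition strict : rel G := fun a b => T a b && (a != b).

Definition height z : nat := #|[set u | T u z]|.

Let HT : tree_order T := proj1 HN.
Let Trefl := tree_refl HT.
Let Ttrans := tree_trans HT.

Lemma tree_antisym a b : T a b -> T b a -> a = b.
Proof. by move=> ab ba; apply: (tree_anti HT); rewrite ab. Qed.

Lemma strictW a b : strict a b -> T a b.
Proof. by case/andP. Qed.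

Lemma strict_not a b : strict a b -> T b a = false.
Proof. by case/andP=> ab; apply: contraNF => /(tree_antisym ab) ->. Qed.

Lemma strict_le_trans b a c : strict a b -> T b c -> strict a c.
Proof.
move=> ab bc; rewrite /strict (Ttrans (strictW ab) bc).
by apply: contraFneq (strict_not ab) => ->.
Qed.

Lemma tree_total a b x : T a x -> T b x -> T a b \/ strict b a.
Proof.
move=> ax bx; case ab: (T a b); [by left|right].
have := tree_chain HT ax bx; rewrite ab /strict /= => ->.
by apply: contraFneq ab => ->.
Qed.

Lemma height_strict a b : strict a b -> height a < height b.
Proof.
move=> ab; apply/proper_card/properP; split.
  by apply/subsetP=> u; rewrite !inE => /Ttrans -> //; apply: strictW.
by exists b; rewrite !inE ?Trefl ?strict_not.
Qed.

Lemma height_le a b : T a b -> height a <= height b.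
Proof.
by move=> ab; apply/subset_leq_card/subsetP=> u; rewrite !inE => /Ttrans ->.
Qed.

Lemma le_of_height a b x : T a x -> T b x -> height a <= height b -> T a b.
Proof.
by move=> ax bx; case: (tree_total ax bx) => // /height_strict; lia.
Qed.

(** Induction on the height of [b]: its lowest proper ancestor [u] is adjacent to it by
    [tree_cover]. The exact vertex set serves later for disjointness and lengths. *)
Lemma tree_path a b : T a b -> exists p,
  [/\ path (@adj G) a p, last a p = b, uniq (a :: p)
    & forall u, (u \in a :: p) = T a u && T u b].
Proof.
have [n] := ubnP (height b); elim: n b => // n IHn b lt_n ab.
have [<-|nab] := eqVneq a b.
  exists [::]; split=> // u; rewrite inE.
  apply/eqP/andP => [->|[]]; first by rewrite Trefl.
  by move=> au ua; apply: tree_antisym.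
have : T a a && strict a b by rewrite /strict Trefl ab.
case/(@arg_maxnP G a (fun u => T a u && strict u b) height).
move=> u /andP[au ub] umax {nab}.
have [|p [ap lp up mp]] := IHn u _ au; first by have := height_strict ub; lia.
have below z : T a z -> T z b -> z = b \/ T z u.
  move=> az zb; have [->|nzb] := eqVneq z b; [by left|right].
  apply: (le_of_height zb (strictW ub)).
  by apply: umax; rewrite az /strict zb.
exists (rcons p b); rewrite last_rcons rcons_path ap lp /=; split=> //.
- have /andP[Tub nub] := ub; apply: (tree_cover HT) => // z uz zb.
  have [->|zu] := below _ (Ttrans au uz) zb; first by rewrite eqxx orbT.
  by rewrite (tree_antisym zu uz) eqxx.
- rewrite -[_ && _]/(uniq (rcons (a :: p) b)) rcons_uniq up mp.
  by rewrite (strict_not ub) andbF.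
- move=> z; rewrite -rcons_cons mem_rcons inE mp.
  apply/idP/andP => [/predU1P[->|/andP[az zu]]|[az zb]].
  + by rewrite ab Trefl.
  + by rewrite az (Ttrans zu (strictW ub)).
  + by have [->|zu] := below _ az zb; rewrite ?eqxx ?az ?zu ?orbT.
Qed.

Lemma tree_path_size a b p : T a b -> uniq (a :: p) ->
  (forall u, (u \in a :: p) = T a u && T u b) -> height b = height a + size p.
Proof.
move=> ab up mp; apply: succn_inj; rewrite -addnS.
have -> : (size p).+1 = #|[set u | T a u && T u b]|.
  by have /card_uniqP /= <- := up; apply: eq_card => u; rewrite mp inE.
rewrite /height -cardsUI -addn1; congr (_ + _).
  apply: eq_card => u; rewrite !inE; apply/idP/orP => [ub|[ua|/andP[]//]].
    have [|au] := tree_total ub ab; first by left.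
    by rewrite ub (strictW au); right.
  exact: Ttrans ua ab.
apply/esym/eqP/cards1P; exists a; apply/setP=> u; rewrite !inE.
apply/and3P/eqP => [[ua au _]|->]; first exact: tree_antisym.
by rewrite Trefl.
Qed.

(** [A] followed by [R] reversed is a closed walk. It may be a single edge walked back and forth,
    which [circ_le] also covers. *)
Lemma two_paths c t A R : path (@adj G) c A -> last c A = t ->
  path (@adj G) c (rcons R t) -> uniq (c :: A ++ R) -> size (c :: A ++ R) <= k.
Proof.
move=> pA lA pR uAR.
have -> : size (c :: A ++ R) = size (c :: A ++ rev R).
  by rewrite /= !size_cat size_rev.
apply: circ_le; rewrite /ucycleb /cycle rcons_cat -rev_cons cat_path pA lA /=.
have := pR; rewrite -(eq_path (fun x y => adj_sym y x)) -rev_path last_rcons.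
rewrite belast_rcons => ->; move: uAR; rewrite /= !cat_uniq mem_cat.
rewrite (perm_uniq (permEl (perm_rev R))) mem_cat mem_rev.
by rewrite (eq_has_r (mem_rev R)).
Qed.

Lemma edge_span s w : T s w -> adj s w -> height w < height s + k.
Proof.
move=> sw esw; have [p [pp lp up mp]] := tree_path sw.
rewrite (tree_path_size sw up mp).
case/lastP: p => [|R t] in pp lp up mp *.
  by move: esw; rewrite -lp /= adj_irr.
rewrite last_rcons in lp; subst t.
have -> : size (rcons R w) = size [:: w & R] by rewrite size_rcons.
rewrite -addnS leq_add2l.
apply: (@two_paths s w [:: w] R) => //=; first by rewrite esw.
by move: up; rewrite /= mem_rcons rcons_uniq.
Qed.

(** * Leapfrogging paths and the depth bound *)

(** The edge [aw] jumps over [t] on the branch to [x]. Its lower end may lie off that branch,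
    provided it leaves the branch below [t]. *)
Definition crossed x t : Prop :=
  exists a w y, [/\ adj a w, strict a t, strict t y, T y x & T y w].

(** Among all jumps over [t], take one whose landing point [z] on the branch is lowest. The 2 arises
    because [s] is strictly above [t] and the edge spans fewer than [k] levels. *)
Lemma furthest_jump x t : T t x -> crossed x t -> exists s w z,
  [/\ [/\ adj s w, strict s t & T z w], [/\ strict t z, T z x &
      height z + 2 <= height t + k] & forall s' w' y,
      strict s' t -> adj s' w' -> T y w' -> T y x -> T y z].
Proof.
move=> tx [a [w0 [y0 [aw0 at0 ty0 y0x y0w0]]]].
pose P (q : G * G * G) :=
  [&& adj q.1.1 q.1.2, strict q.1.1 t, T q.2 q.1.2 & T q.2 x].
have : P (a, w0, y0) by rewrite /P /= aw0 at0 y0w0.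
case/(@arg_maxnP _ (a, w0, y0) P (fun q : G * G * G => height q.2)).
case=> [[s w] z] /and4P[/= sw st zw zx] zmax.
have max s' w' y : strict s' t -> adj s' w' -> T y w' -> T y x -> T y z.
  move=> st' sw' yw' yx; apply: (le_of_height yx zx).
  by apply: (zmax (s', w', y)); rewrite /P /= sw' st' yw'.
have tz : strict t z := strict_le_trans ty0 (max _ _ _ at0 aw0 y0w0 y0x).
exists s, w, z; split=> //; split=> //.
have := edge_span (Ttrans (strictW st) (Ttrans (strictW tz) zw)) sw.
by have := height_strict st; have := height_le zw; clear; lia.
Qed.

(** The jump from [s] to [w], then the climb along the tree from [w] back to the branch at [z]. *)
Lemma jump_path s w z : adj s w -> T z w -> exists D,
  [/\ path (@adj G) s D, last s D = z, uniq D, 0 < size D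
    & forall u, u \in D -> T z u /\ T u w].
Proof.
move=> sw zw; have [p [pp lp up mp]] := tree_path zw.
exists (rev (z :: p)); split.
- rewrite lastI rev_rcons lp /= sw /= -lp rev_path.
  by rewrite (eq_path (fun x y => adj_sym y x)).
- by rewrite rev_cons last_rcons.
- by rewrite rev_uniq.
- by rewrite size_rev.
- by move=> u; rewrite mem_rev mp => /andP.
Qed.

(* Closing a fork by the tree path from [t'] to [t] gives a cycle through all its
   vertices; [fork_max] says that no edge from above [t'] jumps beyond [t]. *)
Record fork_at x t n c t' A B : Prop := ForkAt {
  fork_A : path (@adj G) c A;
  fork_lastA : last c A = t;
  fork_B : path (@adj G) c B;
  fork_lastB : last c B = t';
  fork_uniq : uniq (c :: A ++ B);
  fork_lt : strict t' t;
  fork_size : n <= size (c :: A ++ B);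
  fork_spine : forall u, u \in c :: A ++ B -> T u x -> T u t' \/ u = t;
  fork_below : forall u y, u \in c :: A ++ B -> strict t y -> T y x -> T y u = false;
  fork_max : forall s w y, strict s t' -> adj s w -> T y w -> T y x -> T y t
}.

Definition fork x t n := exists c t' A B, fork_at x t n c t' A B.

(** By [fork_spine], the interior of the tree path from [t'] to [t] avoids the fork, so closing up
    gives a cycle. *)
Lemma fork_bound x t n : T t x -> fork x t n -> n <= k.
Proof.
move=> tx [c [t' [A [B F]]]].
have [p [pp lp up mp]] := tree_path (strictW (fork_lt F)).
case/lastP: p => [|R z] in pp lp up mp *.
  by have := fork_lt F; rewrite /strict -lp eqxx andbF.
rewrite last_rcons in lp; subst z.
apply: leq_trans (fork_size F) (leq_trans _ (@two_paths c t A (B ++ R) _ _ _ _)).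
- by rewrite catA /= !size_cat; lia.
- exact: fork_A F.
- exact: fork_lastA F.
- by rewrite rcons_cat cat_path (fork_B F) (fork_lastB F).
rewrite catA -cat_cons cat_uniq (fork_uniq F) /=.
move: up; rewrite -rcons_cons rcons_uniq /= => /andP[tR /andP[t'R ->]].
rewrite andbT; apply/hasPn => u uR; apply/negP => uF.
have := mp u; rewrite -rcons_cons mem_rcons !inE uR !orbT => /esym/andP[t'u ut].
case: (fork_spine F uF (Ttrans ut tx)) => [ut'|E].
  by rewrite (tree_antisym t'u ut') uR in t'R.
by move: tR; rewrite inE -E uR orbT.
Qed.

(** From [s], one path makes the furthest jump over [r] and the other follows the tree down to [r].
    The 3 counts [s] and one vertex on each path. *)
Lemma fork_start x r : T r x -> crossed x r -> exists t,
  [/\ strict r t, T t x, height t + 2 <= height r + k & fork x t 3].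
Proof.
move=> rx /(furthest_jump rx).
case=> [s [w [z [[sw sr zw] [rz zx hz] zmax]]]].
have [D [pD lD uD D0 mD]] := jump_path sw zw.
have [p [pp lp up mp]] := tree_path (strictW sr).
have p0 : 0 < size p.
  by case: p {pp up mp} lp => //= E; move: sr; rewrite /strict E eqxx andbF.
have memF u : u \in s :: D ++ p -> T u r \/ u \in D.
  rewrite inE mem_cat => H; have : (u \in s :: p) || (u \in D).
    by rewrite inE; case/or3P: H => ->; rewrite ?orbT.
  by rewrite mp => /orP[/andP[]|]; [left|right].
exists z; split=> //; exists s, r, D, p; split=> //.
- rewrite -[s :: D ++ p]/([:: s] ++ D ++ p) uniq_catCA cat_uniq uD.
  rewrite -[[:: s] ++ p]/(s :: p) up andbT; apply/hasPn => u.
  rewrite mp => /andP[_ ur]; apply/negP => /mD[zu _].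
  by have := strict_not rz; rewrite (Ttrans zu ur).
- by rewrite /= size_cat; move: D0 p0; clear; lia.
(* As [z] is the lowest landing point, the jump path meets the branch only in [z]. *)
- move=> u /memF[|/mD[zu uw]] ux; [by left|right].
  exact: tree_antisym (zmax _ _ _ sr sw uw ux) zu.
- move=> u y /memF uF zy yx; apply/negP => yu.
  case: uF => [ur|/mD[_ uw]].
    by have := strict_not rz; rewrite (Ttrans (Ttrans (strictW zy) yu) ur).
  by have := strict_not zy; rewrite (zmax _ _ _ sr sw (Ttrans yu uw) yx).
Qed.

(** The path ending at [t'] follows the tree to [s] and jumps over [t] to [z]. The two paths thereby
    exchange roles. *)
Lemma fork_step x t n : T t x -> crossed x t -> fork x t n -> exists z,
  [/\ strict t z, T z x, height z + 2 <= height t + k & fork x z n.+1].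
Proof.
move=> tx /(furthest_jump tx).
case=> [s [w [z [[sw st zw] [tz zx hz] zmax]]]] [c [t' [A [B F]]]].
have [D [pD lD uD D0 mD]] := jump_path sw zw.
(* From strictly above [t'], no edge reaches beyond [t] by [fork_max], yet [z] is strictly below
   [t]. *)
have t's : T t' s.
  have [//|st'] := tree_total (strictW (fork_lt F)) (strictW st).
  by have := strict_not tz; rewrite (fork_max F st' sw zw zx).
have [p [pp lp up mp]] := tree_path t's.
have mp' u : u \in p -> strict t' u /\ T u s.
  move=> uip; have := mp u; rewrite inE uip orbT => /esym/andP[t'u ->].
  split=> //; rewrite /strict t'u; apply: contraTneq up => ->.
  by rewrite /= uip.
have memF u : u \in c :: (B ++ p ++ D) ++ A ->
    [\/ u \in c :: A ++ B, u \in p | u \in D].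
  move=> H; have [/orP[uAB|uip]|] := boolP ((u \in c :: A ++ B) || (u \in p)).
  - by constructor 1.
  - by constructor 2.
  move=> nu; constructor 3; move: nu H; rewrite !inE !mem_cat !negb_or.
  by case/andP=> /and3P[/negbTE-> /negbTE-> /negbTE->] /negbTE->; rewrite orbF.
exists z; split=> //; exists c, t, (B ++ p ++ D), A; split.
- by rewrite !cat_path (fork_B F) (fork_lastB F) pp lp.
- by rewrite !last_cat (fork_lastB F) lp.
- exact: fork_A F.
- exact: fork_lastA F.
- rewrite (_ : uniq _ = uniq ((c :: A ++ B) ++ p ++ D)); last first.
    by apply: perm_uniq; rewrite /= perm_cons perm_catC -catA.
  (* [p] lies strictly between [t'] and [t], where [fork_spine] excludes the old fork; [D] lies in
     the subtree of [z], where [fork_below] does. *)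
  rewrite cat_uniq (fork_uniq F) cat_uniq uD /=.
  move: up => /= /andP[_ ->] /=; rewrite andbT; apply/andP; split.
    apply/hasPn => u; rewrite mem_cat => uip; apply/negP => uF.
    case/orP: uip => [/mp'[t'u us]|/mD[zu _]].
      case: (fork_spine F uF (Ttrans us (Ttrans (strictW st) tx))) => [ut'|E].
        by have := strict_not t'u; rewrite ut'.
      by have := strict_not st; rewrite -E us.
    by have := fork_below F uF tz zx; rewrite zu.
  apply/hasPn => u /mD[zu _]; apply/negP => /mp'[_ us].
  have := strict_not tz; rewrite (Ttrans zu) //.
  exact: Ttrans us (strictW st).
- exact: tz.
- by have := fork_size F; rewrite /= !size_cat; move: D0; clear; lia.
- move=> u /memF[uF|/mp'[_ us]|/mD[zu uw]] ux.
  + by left; case: (fork_spine F uF ux) => [/Ttrans->|->] //; apply: strictW (fork_lt F).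
  + by left; apply: Ttrans us (strictW st).
  + by right; apply: tree_antisym (zmax _ _ _ st sw uw ux) zu.
- move=> u y /memF uM zy yx; apply/negP => yu.
  have ty := strict_le_trans tz (strictW zy).
  case: uM => [uF|/mp'[_ us]|/mD[_ uw]].
  + by have := fork_below F uF ty yx; rewrite yu.
  + by have := strict_not ty; rewrite (Ttrans yu (Ttrans us (strictW st))).
  + by have := strict_not zy; rewrite (zmax _ _ _ st sw (Ttrans yu uw) yx).
- exact: zmax.
Qed.

(** The [j]-th fork has at least [j + 2] vertices, hence [j <= k - 2], and its lower end is at most
    [j * (k - 2)] levels below [r]. *)
Lemma crossed_height r x : T r x ->
  (forall y, T r y -> strict y x -> crossed x y) ->
  height x <= height r + (k - 2) * (k - 2).
Proof.
move=> rx crossP.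
suff H n t j : height x - height t < n -> T r t -> T t x ->
    height t <= height r + j * (k - 2) -> fork x t j.+2 ->
    height x <= height r + (k - 2) * (k - 2).
  have [->|nrx] := eqVneq r x; first by rewrite leq_addr.
  have srx : strict r x by rewrite /strict rx.
  have [t [rt tx ht F]] := fork_start rx (crossP _ (Trefl r) srx).
  by apply: (H _ t 1 (ltnSn _) (strictW rt) tx _ F); lia.
elim: n t j => // n IHn t j lt_n rt tx ht F.
have jk : j.+2 <= k := fork_bound tx F.
have [E|ntx] := eqVneq t x.
  by rewrite -E; apply: leq_trans ht _; rewrite leq_add2l leq_mul2r; lia.
have stx : strict t x by rewrite /strict tx.
have [z [tz zx hz Fz]] := fork_step tx (crossP _ rt stx) F.
apply: (IHn z j.+1) => //; last by lia.
  by have := height_strict tz; have := height_le zx; lia.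
exact: Ttrans rt (strictW tz).
Qed.

End NormalTrees.

(** * Edges crossing a cut of a component, and short closed walks *)

Lemma connect_cut (V : finType) (e : rel V) (S : pred V) r x :
  connect e r x -> ~~ S r -> S x ->
  exists u w, [/\ connect e r u, e u w, ~~ S u & S w].
Proof.
case/connectP=> p; elim: p r => [|z p IHp] r /=; first by move=> _ -> /negbTE->.
case/andP=> rz zp lp nSr Sx; have [Sz|nSz] := boolP (S z).
  by exists r, z; rewrite connect0.
have [u [w [zu uw nSu Sw]]] := IHp z zp lp nSz Sx; exists u, w; split=> //.
exact: connect_trans (connect1 rz) zu.
Qed.

Lemma component_cut (G : graph) (C : eqType) (f : G -> C) (M : {set G})
    (S : pred G) r x :
  monochromatic_component f M -> r \in M -> x \in M -> ~~ S r -> S x ->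
  exists u w, [/\ u \in M, w \in M & adj u w] /\ [/\ f u = f w, ~~ S u & S w].
Proof.
case=> c; set A := [set z | _] => /imsetP[x0 _ ->]; rewrite !inE.
have sym : symmetric (induced_adj A).
  by move=> u w; rewrite /induced_adj /= adj_sym; case: (u \in A); case: (w \in A).
move=> /andP[_ x0r] /andP[_ x0x] nSr Sx.
have rx : connect (induced_adj A) r x.
  by apply: (connect_trans _ x0x); rewrite (sym_connect_sym sym).
have [u [w [ru euw nSu Sw]]] := connect_cut rx nSr Sx.
have x0u := connect_trans x0r ru; have x0w := connect_trans x0u (connect1 euw).
have /and3P[uA wA uw] := euw; exists u, w; rewrite !inE x0u x0w.
by move: uA wA; rewrite !inE => /eqP-> /eqP->; rewrite eqxx.
Qed.

Lemma common_neighbour_uniq (G : graph) (a u w w' : G) :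
  girth_at_least G 5 -> a != u -> adj a w -> adj u w -> adj a w' -> adj u w' ->
  w = w'.
Proof.
move=> /girth_at_leastP girth5 au aw uw aw' uw'; apply/eqP/negPn/negP => ww'.
suff /girth5 : is_cycle [:: a; w; u; w'] by [].
have neq (y z : G) : adj y z -> y == z = false.
  by move=> yz; apply: contraTF yz => /eqP->; rewrite adj_irr.
rewrite /is_cycle /ucycleb /= aw uw' (adj_sym w) (adj_sym w') uw aw' !inE.
rewrite (negbTE au) (neq _ _ aw) (neq _ _ aw') (negbTE ww') (neq _ _ uw').
by rewrite eq_sym (neq _ _ uw).
Qed.

Lemma circumference_ge2 (G : graph) : 2 <= circumference G.
Proof.
have [/circumference_forest->//|nF] := boolP (forest G).
by have [c /andP[/ltnW ? _] <-] := circumference_attained nF.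
Qed.

(** Closed walks too short to be cycles have at most 2 vertices, which the circumference allows even
    for forests. *)
Lemma ucycle_size_le (G : graph) (c : seq G) :
  ucycleb (@adj G) c -> size c <= circumference G.
Proof.
move=> cc; have [le2|lt2] := leqP (size c) 2.
  exact: leq_trans le2 (circumference_ge2 G).
by apply: circumference_max; rewrite /is_cycle lt2.
Qed.

(** * The colouring along the forest *)

Section Colour.
Variables (G : graph) (T : rel G) (k : nat).
Hypotheses (HN : normal_order T)
           (circ_le : forall c : seq G, ucycleb (@adj G) c -> size c <= k).
Implicit Types (a r u w x y z : G) (M : {set G}) (f : G -> bool).

Let Trefl := tree_refl (proj1 HN).
Let Ttrans := tree_trans (proj1 HN).

(** What the colouring rule yields: a neighbour of [z] above it with the same colour is not the
    highest such neighbour. *)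
Definition alternating f : Prop := forall u z,
  T u z -> adj u z -> f u = f z -> exists2 a, adj a z & strict T a u.

Lemma alternating_exists : exists f, alternating f.
Proof.
suff H n : exists f, forall u z, height T z <= n ->
    T u z -> adj u z -> f u = f z -> exists2 a, adj a z & strict T a u.
  by have [f fP] := H #|G|; exists f => u z; apply/fP/max_card.
elim: n => [|n [f fP]].
  (* Heights count the vertex itself, so no vertex has height 0. *)
  exists xpredT => u z; rewrite leqn0 cards_eq0 => /eqP/setP/(_ z).
  by rewrite !inE Trefl.
pose top z :=
  [pick a | [&& T a z, adj a z & [forall b, T b z && adj b z ==> T a b]]].
(* Neighbours above a vertex of height [n.+1] are already coloured. A vertex with no neighbour above
   gets [false] arbitrarily. *)
exists (fun z => if height T z <= n then f z else
          if top z is Some a then ~~ f a else false) => u z hz uz euz.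
have lt_z a : T a z -> adj a z -> height T a < height T z.
  move=> az eaz; apply: height_strict => //; rewrite /strict az.
  by apply: contraTneq eaz => ->; rewrite adj_irr.
have -> : height T u <= n by have := lt_z _ uz euz; lia.
case: ifP => [hzn|hzn]; first exact: fP.
rewrite /top; case: pickP => [a /and3P[az eaz /forallP amin] fuz|none].
  exists a => //; have := amin u; rewrite uz euz /strict => /= ->.
  by apply/eqP=> E; move: fuz; rewrite E; case: (f u).
have : T u z && adj u z by rewrite uz.
case/(@arg_minnP G u (fun b => T b z && adj b z) (height T)) => a.
case/andP=> az eaz amin; case/negP: (negbT (none a)); rewrite az eaz /=.
apply/forallP=> b; apply/implyP=> /andP[bz ebz].
by apply: (le_of_height HN az bz); apply: amin; rewrite bz.
Qed.

Lemma alternating_proper f v :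
  alternating f -> minimal T v -> properly_coloured f v.
Proof.
move=> fP vmin w vw; apply/eqP=> E.
have vw' : T v w.
  case/orP: (proj2 HN _ _ vw) => // /vmin wv.
  by rewrite wv adj_irr in vw.
by have [a _ /andP[/vmin ->]] := fP _ _ vw' vw E; rewrite eqxx.
Qed.

(** The parent-child relation of the forest. *)
Definition covers y z : bool := strict T y z && [forall u, strict T u z ==> T u y].

Lemma cover_towards y x : strict T y x -> exists2 z, covers y z & T z x.
Proof.
move=> yx; have : strict T y x && T x x by rewrite yx Trefl.
case/(@arg_minnP G x (fun z => strict T y z && T z x) (height T)).
move=> z /andP[yz zx] zmin; exists z => //; rewrite /covers yz /=.
apply/forallP=> u; apply/implyP=> uz.
have [//|yu] := tree_total HN (strictW uz) (strictW yz).
have := zmin u; rewrite yu (Ttrans (strictW uz) zx) => /(_ isT).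
by have := height_strict HN uz; lia.
Qed.

Lemma covers_uniq y z z' w : covers y z -> covers y z' -> T z w -> T z' w -> z = z'.
Proof.
case/andP=> yz /forallP zc /andP[yz' /forallP zc'] zw zw'.
apply/eqP/negPn/negP => nz.
case/orP: (tree_chain (proj1 HN) zw zw') => le.
  have := zc' z; rewrite /strict le nz /=.
  by rewrite (strict_not HN yz).
have := zc z'; rewrite /strict le eq_sym nz /=.
by rewrite (strict_not HN yz').
Qed.

(** Ancestors of [y] form a chain, so their height differences to [y], here below [k], tell them
    apart. *)
Lemma card_near_ancestors y : #|[set u | T u y & height T y < height T u + k]| <= k.
Proof.
rewrite cardE -(size_map (fun u => height T y - height T u)) -[leqRHS](size_iota 0).
apply: uniq_leq_size => [|m /mapP[u]]; last first.
  by rewrite mem_enum inE mem_iota => /andP[uy hy] ->; have := height_le HN uy; lia.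
rewrite map_inj_in_uniq ?enum_uniq // => u u'.
rewrite !mem_enum !inE => /andP[uy _] /andP[uy' _] E.
have := height_le HN uy; have := height_le HN uy' => hy' hy.
have hu : height T u = height T u' by lia.
by apply: (tree_antisym HN); apply: (le_of_height HN (x := y)); rewrite ?hu.
Qed.

(** * Depth, branching and size of a monochromatic component *)

Section Component.
Variables (f : G -> bool) (M : {set G}) (r : G).
Hypotheses (fP : alternating f) (HM : monochromatic_component f M) (rM : r \in M)
           (rmin : forall x, x \in M -> height T r <= height T x).

(** An edge of [M] leaving the subtree of [r] would end at a proper ancestor of [r], against the
    minimal height of [r]. *)
Lemma component_top x : x \in M -> T r x.
Proof.
move=> xM; apply/negPn/negP => nrx.
have [||u [w [[_ wM uw] [_ /negPn ru nrw]]]] :=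
    component_cut (S := fun z => ~~ T r z) HM rM xM; rewrite ?Trefl //.
case/negP: nrw; case/orP: (proj2 HN _ _ uw) => [|wu]; first exact: Ttrans.
by apply: (le_of_height HN ru wu); apply: rmin.
Qed.

(** [M] is connected and [r] lies outside the subtree of [z], so a monochromatic edge [uw] enters
    that subtree; the colouring supplies [a]. Both the depth and the branching bound rest on
    this. *)
Lemma component_crossing x y z : x \in M -> T r y -> covers y z -> T z x ->
  exists a u w, [/\ adj a w, adj u w, strict T a u, T u y & T z w].
Proof.
move=> xM ry /andP[yz /forallP zc] zx.
have [|u [w [[uM wM uw] [fuw nzu zw]]]] := component_cut HM rM xM _ zx.
  by apply/negP => /Ttrans/(_ ry); rewrite strict_not.
have uw' : T u w.
  by case/orP: (proj2 HN _ _ uw) => // /(Ttrans zw); rewrite (negbTE nzu).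
have [a aw au] := fP uw' uw fuw; exists a, u, w; split=> //.
have [/(negP nzu)//|uz] := tree_total HN zw uw'.
by have := zc u; rewrite uz.
Qed.

Lemma component_height x : x \in M -> height T x <= height T r + (k - 2) * (k - 2).
Proof.
move=> xM; apply: (crossed_height HN circ_le (component_top xM)) => y ry yx.
have [z yz zx] := cover_towards yx.
have [a [u [w [aw _ au uy zw]]]] := component_crossing xM ry yz zx.
exists a, w, z; split=> //; first exact: strict_le_trans au uy.
by case/andP: yz.
Qed.

Hypothesis girth5 : girth_at_least G 5.

(** The pair [(a, u)] determines the child: it fixes the common neighbour [w], which lies below one
    child of [y] only. *)
Lemma card_children y : T r y ->
  #|[set z | covers y z & [exists x in M, T z x]]| <= k * k.
Proof.
move=> ry; pose K := [set u | T u y & height T y < height T u + k].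
(* [g] recovers the child from the pair; [y] is a default for pairs that yield no child. *)
pose g (p : G * G) := odflt y [pick z | covers y z &&
  [exists w, [&& adj p.1 w, adj p.2 w & T z w]]].
have Kk : #|setX K K| <= k * k.
  by rewrite cardsX leq_mul // card_near_ancestors.
apply: leq_trans Kk; apply: leq_trans (leq_imset_card g _).
apply/subset_leq_card/subsetP => z; rewrite inE.
case/andP=> yz /exists_inP[x xM zx].
have [a [u [w [aw uw au uy zw]]]] := component_crossing xM ry yz zx.
have hyw : height T y < height T w.
  by case/andP: yz => /(height_strict HN) h _; apply: leq_trans h (height_le HN zw).
have yw : T y w by case/andP: yz => /strictW /Ttrans /(_ zw).
have near b : T b y -> adj b w -> b \in K.
  move=> b_y bw; rewrite inE b_y /=; apply: ltn_trans hyw _.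
  exact: (edge_span HN circ_le (Ttrans b_y yw) bw).
apply/imsetP; exists (a, u).
  by rewrite inE /= !near // (Ttrans (strictW au) uy).
rewrite /g; case: pickP => [z' /andP[yz' /existsP[w' /and3P[/= aw' uw' zw']]]|none].
  case/andP: au => _ nau.
  rewrite -(common_neighbour_uniq girth5 nau aw uw aw' uw') in zw'.
  exact: covers_uniq yz yz' zw zw'.
have := none z; rewrite yz /= => /existsP[]; exists w.
by rewrite /= aw uw.
Qed.

(** Induction on the depth: [y] contributes at most 1 and each of at most [k * k] children a subtree
    of depth [n], whence the base [(k * k).+1]. *)
Lemma card_component_below n y : T r y ->
  (forall x, x \in M -> T y x -> height T x <= height T y + n) ->
  #|[set x in M | T y x]| <= (k * k).+1 ^ n.
Proof.
elim: n y => [|n IHn] y ry hM.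
  rewrite expn0 -(cards1 y); apply/subset_leq_card/subsetP => x.
  rewrite !inE => /andP[xM yx]; apply/eqP/esym/eqP/negPn/negP => nyx.
  have := height_strict HN (introT andP (conj yx nyx)).
  by have := hM x xM yx; lia.
pose Ch := [set z | covers y z & [exists x in M, T z x]].
have sub : [set x in M | T y x] \subset
    y |: \bigcup_(z in Ch) [set x in M | T z x].
  apply/subsetP=> x; rewrite !inE => /andP[xM yx].
  have [//|/= nxy] := eqVneq x y.
  have [|z yz zx] := @cover_towards y x; first by rewrite /strict yx eq_sym.
  apply/bigcupP; exists z; rewrite inE ?xM // yz /=.
  by apply/exists_inP; exists x.
apply: leq_trans (subset_leq_card sub) _.
rewrite cardsU1 expnS mulSn; apply: leq_add.
  by apply: leq_trans (leq_b1 _) _; rewrite expn_gt0.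
apply: (@leq_trans (\sum_(z in Ch) #|[set x in M | T z x]|)).
  elim/big_rec2: _ => [|z m A _ IH]; first by rewrite cards0.
  by apply: leq_trans (leq_card_setU _ _) _; rewrite leq_add2l.
apply: (@leq_trans (\sum_(z in Ch) (k * k).+1 ^ n)); last first.
  by rewrite sum_nat_const leq_mul2r card_children ?orbT.
apply: leq_sum => z; rewrite inE => /andP[/andP[yz _] _]; apply: IHn.
  exact: Ttrans ry (strictW yz).
move=> x xM zx; have := hM x xM (Ttrans (strictW yz) zx).
by have := height_strict HN yz; lia.
Qed.

Lemma card_component : #|M| <= (k * k).+1 ^ ((k - 2) * (k - 2)).
Proof.
have -> : M = [set x in M | T r x].
  by apply/setP=> x; rewrite inE andb_idr //; apply: component_top.
by apply: card_component_below => // x xM _; apply: component_height.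
Qed.

End Component.
End Colour.

Theorem theorem19 (G : graph) (k : nat)
    (circ_G : circumference G = k) (girth_G : girth_at_least G 5) (v : G) :
  exists f : G -> bool,
    has_clustering f ((4 * k ^ 2) ^ (k ^ 2)) /\ properly_coloured f v.
Proof.
have [T [HN vmin]] := normal_order_exists v.
have [f fP] := alternating_exists HN.
exists f; split; last exact: alternating_proper fP vmin.
have circ_le (c : seq G) : ucycleb (@adj G) c -> size c <= k.
  by rewrite -circ_G; apply: ucycle_size_le.
have k2 : 2 <= k by rewrite -circ_G circumference_ge2.
move=> M HM; have [x0 x0M] : exists x, x \in M.
  case: HM => c /imsetP[x xA ->]; exists x.
  by rewrite inE xA connect0.
have [r rM rmin] := @arg_minnP G x0 (mem M) (height T) x0M.
apply: leq_trans (card_component HN circ_le fP HM rM rmin girth_G) _.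
(* First enlarge the base, as [k * k + 1 <= 4 * k ^ 2], then the exponent; exponent 0 is split off
   because [leq_exp2r] requires a positive one. *)
apply: leq_trans (_ : (4 * k ^ 2) ^ ((k - 2) * (k - 2)) <= _).
  by case: ((k - 2) * (k - 2)) => // m; rewrite leq_exp2r //; nia.
by rewrite leq_pexp2l //; nia.
Qed.
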